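(* Let $G$ be a finite group, and let $G = G_1G_2$ be the product of msp-permutable subgroups $G_1$ and $G_2$. Then the following statements hold: (1) If $G_1, G_2\in \mathfrak U$, then $G\in \mathfrak U$ (that is, if $G_1$ and $G_2$ are supersoluble, then $G$ is supersoluble). (2) If $G_1, G_2\in \mathrm{w}\mathfrak U$, then $G\in \mathrm{w}\mathfrak U$. (3) If $G_1, G_2\in \mathrm{v}\mathfrak U$, then $G\in \mathrm{v}\mathfrak U$.
   Context: All groups are finite. Two subgroups $X$ and $Y$ of a group are called mutually permutable if $UY=YU$ and $XV=VX$ for all subgroups $U\le X$ and $V\le Y$. Subgroups $A$ and $B$ of a group $G$ are called msp-permutable if: (i) $AB$ is a subgroup of $G$; (ii) whenever $p\neq q$ are primes, $P$ is an arbitrary Sylow $p$-subgroup of $A$ and $Q$ is an arbitrary Sylow $q$-subgroup of $B$, the subgroups $P$ and $Q$ are mutually permutable. $\mathfrak U$ denotes the class of all supersoluble groups, i.e. groups all of whose chief factors have prime order. Let $\mathbb P$ be the set of all primes. A subgroup $H$ of a group $G$ is called $\mathbb P$-subnormal in $G$ if either $H=G$ or there is a chain of subgroups $H=H_0\le H_1\le\ldots\le H_n=G$ with $|H_i:H_{i-1}|\in\mathbb P$ for all $i$. $\mathrm{w}\mathfrak U$ denotes the class of all groups in which every Sylow subgroup is $\mathbb P$-subnormal. $\mathrm{v}\mathfrak U$ denotes the class of all groups in which every primary cyclic subgroup (cyclic subgroup of prime power order) is $\mathbb P$-subnormal. *)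

(* Defs.v *)
From mathcomp Require Import all_boot all_fingroup all_solvable.

Set Implicit Arguments.
Unset Strict Implicit.
Unset Printing Implicit Defensive.

Local Open Scope group_scope.

Definition mutually_permutable (gT : finGroupType) (X Y : {group gT}) : Prop :=
  (forall U : {group gT}, U \subset X -> U * Y = Y * U) /\
  (forall V : {group gT}, V \subset Y -> X * V = V * X).

Definition msp_permutable (gT : finGroupType) (A B : {group gT}) : Prop :=
  group_set (A * B) /\
  forall (p q : nat) (P Q : {group gT}),
    prime p -> prime q -> p != q -> p.-Sylow(A) P -> q.-Sylow(B) Q ->
    mutually_permutable P Q.

Definition supersoluble (gT : finGroupType) (G : {group gT}) : Prop :=
  forall V U : {group gT}, chief_factor G V U -> prime #|U / V|.

(* The sequence s lists H_1, ..., H_n (H_0 = H is the head of the path), so the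
   case H = G is the empty sequence.  The inclusion must be required because
   #|K : L| is the index of K :&: L in K when L is not contained in K. *)
Definition P_subnormal (gT : finGroupType) (H G : {group gT}) : Prop :=
  exists s : seq {group gT},
    path [rel L K : {group gT} | (L \subset K) && prime #|K : L|] H s
    /\ last H s = G.

Definition w_supersoluble (gT : finGroupType) (G : {group gT}) : Prop :=
  forall (p : nat) (P : {group gT}),
    prime p -> p.-Sylow(G) P -> P_subnormal P G.

Definition v_supersoluble (gT : finGroupType) (G : {group gT}) : Prop :=
  forall (p : nat) (C : {group gT}),
    prime p -> C \subset G -> cyclic C -> p.-group C -> P_subnormal C G.

(* Main.v *)
Require Import Defs.
From mathcomp Require Import all_boot all_fingroup all_solvable.
From mathcomp Require Import all_algebra all_field all_character.

(** Supersolubility, wU and vU are treated uniformly as the condition that all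
    subgroups of a given kind are P-subnormal: all subgroups, the Sylow
    subgroups, or the cyclic subgroups of prime power order.

    Let p be the largest prime divisor of the order of G = AB. A P-subnormal
    p-subgroup lies in O_p ([P_subnormal_sub_pcore]), so A and B have normal
    Sylow p-subgroups A_p and B_p. If Q <> 1 is a Sylow q-subgroup of B with q
    <> p, then q < p, and mutual permutability of A_p and Q makes A_p, and then
    each subgroup of A_p, normalised by Q ([mutually_permutable_normalizes]);
    the same holds with A and B exchanged. Hence P = A_p B_p is a normal Sylow
    p-subgroup of G, and by induction G / P belongs to the class. What is left
    is the action of the p'-subgroups of G on P.

    Whether a p'-subgroup L normalising a p-group P is P-subnormal in LP is
    decided by that action: it is so exactly when L acts on P as an abelian
    group of exponent dividing p - 1. Indeed L then acts on each chief factor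
    of LP below P, and prime order of such a factor means that L acts on it
    through the multiplicative group of the field with p elements. One
    direction is [P_subnormal_exponent_action], the other is
    [P_subnormal_joinG], which rests on the existence of eigenvectors. By
    coprime action it is enough to know the action on P / Phi(P), and this
    elementary abelian group is the product of the images of A_p and B_p. On
    the image of A_p, a Hall pi-subgroup X of A, with p not in pi, acts as the
    class of A prescribes, whereas a Hall pi-subgroup Y of B acts by scalars,
    which commute with the action of X and have order dividing p - 1; so XY
    satisfies the same condition as X ([exponent_action_mul]). Here pi consists
    of all primes other than p for supersolubility, and of a single one for wU
    and vU; for vU the condition bounds the exponent only. Every subgroup of G
    that has to be examined lies in a conjugate of such a product XY
    ([factorized_Hall]).

    Finally, a group all of whose subgroups are P-subnormal is supersoluble: a
    chief factor is a minimal normal subgroup of a quotient, and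
    [minnormal_prime] finds its order by the same eigenvector argument. *)

Set Implicit Arguments.
Unset Strict Implicit.
Unset Printing Implicit Defensive.
Local Open Scope group_scope.

(** * P-subnormal subgroups *)

Lemma P_subnormal_refl (gT : finGroupType) (G : {group gT}) : P_subnormal G G.
Proof. by exists [::]. Qed.

Lemma P_subnormal_trans (gT : finGroupType) (K H G : {group gT}) :
  P_subnormal H K -> P_subnormal K G -> P_subnormal H G.
Proof.
move=> [s [ps ls]] [t [pt lt]]; exists (s ++ t).
by rewrite cat_path last_cat ls ps pt.
Qed.

(** Induction upwards along a chain, for properties whose inductive step needs
    to know that the chain stays inside G. *)
Lemma P_subnormal_ind (gT : finGroupType) (Q : {group gT} -> Prop)
    (H G : {group gT}) :
    (forall L K : {group gT}, L \subset K -> K \subset G -> prime #|K : L| ->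
       Q L -> Q K) ->
  Q H -> P_subnormal H G -> Q G.
Proof.
move=> QS QH [s [ps ls]]; subst G.
have sub_last (L : {group gT}) t :
    path [rel L K : {group gT} | (L \subset K) && prime #|K : L|] L t ->
  L \subset last L t.
  elim: t L => //= K t IHt L /andP[/andP[sLK _] /IHt]; exact: subset_trans.
elim: s H QS QH ps => //= K s IHs H QS QH /andP[/andP[sHK pr] ps].
apply: IHs => //; exact: QS (sub_last _ _ ps) pr QH.
Qed.

(** Dividing a prime, rather than being one, is what an index inherits when a
    chain is multiplied by a subgroup or mapped to a quotient. *)
Lemma P_subnormal_step (gT : finGroupType) (H G : {group gT}) (r : nat) :
  prime r -> H \subset G -> #|G : H| %| r -> P_subnormal H G.
Proof.
move=> pr_r sHG dvd_r.
have [eq1 | ne1] := eqVneq #|G : H| 1%N.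
  suff -> : G = H by apply: P_subnormal_refl.
  by apply/group_inj/eqP; rewrite eqEsubset sHG -indexg_eq1 eq1 eqxx.
exists [:: G]; split=> //=; rewrite sHG andbT /=.
have /primeP[_ r_div] := pr_r.
by have /orP[/eqP e1 | /eqP -> //] := r_div _ dvd_r; rewrite e1 in ne1.
Qed.

(** In the action of K on the cosets of M, the p-group X fixes the coset M, so
    it permutes the fewer than p remaining ones; its orbits have p-power
    length, so it fixes them all. The count is made below on a single double
    coset. *)
Lemma pcore_sub_core_prime_index (gT : finGroupType) (p : nat)
    (M K X : {group gT}) :
    prime p -> M \subset K -> #|K : M| <= p -> X \subset M -> p.-group X ->
  {in K, forall h, X \subset M :^ h}.
Proof.
move=> pr_p sMK leKp sXM pX h Kh; apply/idPn=> nsXMh.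
have ltp : p <= #|X : M :^ h|.
  rewrite -indexgI.
  have [k Dk] := p_natP (pnat_dvd (dvdn_indexg X (X :&: M :^ h)) pX).
  case: k Dk => [/eqP | k ->].
    by rewrite expn0 indexg_eq1 subsetI subxx (negPf nsXMh).
  by rewrite expnS leq_pmulr ?expn_gt0 ?prime_gt0.
(* The double coset M h X, here translated by h^-1, already exhausts K. *)
have eqK : (M :^ h) * X = K.
  apply/eqP; rewrite eqEcard mul_subG ?(subset_trans sXM) //=; last first.
    by rewrite -(conjGid Kh) conjSg.
  rewrite -LagrangeMl cardJg -(Lagrange sMK) leq_mul2l.
  by rewrite (leq_trans leKp) ?orbT.
have : h^-1 \in M :^ h * X by rewrite eqK groupV.
case/mulsgP=> _ x /imsetP[m Mm ->] Xx; rewrite conjgE -!mulgA => Dh.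
have Mh : h \in M.
  have mhx : m * (h * x) = 1 by apply: (mulgI h^-1); rewrite -Dh mulg1.
  have hx : h * x = m^-1 by apply: (mulgI m); rewrite mhx mulgV.
  have -> : h = m^-1 * x^-1 by rewrite -hx mulgK.
  by rewrite groupM ?groupV // (subsetP sXM).
by move: nsXMh; rewrite conjGid ?sXM.
Qed.

(** O_p(M) lies in the normal core of M in K, and so in the O_p of that core,
    which is normal in K. *)
Lemma pcore_prime_index_sub (gT : finGroupType) (p : nat) (M K : {group gT}) :
  prime p -> M \subset K -> #|K : M| <= p -> 'O_p(M) \subset 'O_p(K).
Proof.
move=> pr_p sMK leKp.
have sOcore : 'O_p(M) \subset gcore M K.
  apply/bigcapsP=> h Kh.
  exact: (pcore_sub_core_prime_index pr_p sMK leKp (pcore_sub p M)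
            (pcore_pgroup p M)).
have scoreM : gcore M K \subset M by apply: gcore_sub.
have sOO : 'O_p(M) \subset 'O_p(gcore M K).
  apply: pcore_max (pcore_pgroup p M) _.
  exact: normalS sOcore scoreM (pcore_normal p M).
apply: subset_trans sOO (pcore_max (pcore_pgroup p _) _).
apply: gFnormal_trans; apply: gcore_normal sMK.
Qed.

Lemma P_subnormal_sub_pcore (gT : finGroupType) (p : nat) (X G : {group gT}) :
    prime p -> {in \pi(G), forall q, q <= p} -> p.-group X ->
  P_subnormal X G -> X \subset 'O_p(G).
Proof.
move=> pr_p le_p pX.
apply: (P_subnormal_ind (Q := fun K => X \subset 'O_p(K))); last first.
  by rewrite pcore_pgroup_id.
move=> L K sLK sKG prKL sXL; apply: subset_trans sXL _.
apply: pcore_prime_index_sub => //; apply: le_p.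
rewrite mem_primes prKL cardG_gt0 /=.
exact: dvdn_trans (dvdn_indexg K L) (cardSg sKG).
Qed.

(** * Actions of exponent dividing p - 1 *)

(** H acts on P with exponent dividing p - 1 and, when [ab] holds, as an
    abelian group. If P is elementary abelian and [ab] holds, this says that H
    is diagonalisable over the field with p elements. The bound on the exponent
    alone holds for H as soon as it holds for its cyclic subgroups. *)
Definition exponent_action (gT : finGroupType) (ab : bool) (p : nat)
    (H P : {set gT}) : Prop :=
  (ab -> [~: H, H] \subset 'C(P)) /\
  {in H, forall x, x ^+ p.-1 \in 'C(P)}.

Lemma exponent_actionS (gT : finGroupType) (ab : bool) (p : nat)
    (K H Q P : {set gT}) :
    K \subset H -> Q \subset P ->
  exponent_action ab p H P -> exponent_action ab p K Q.
Proof.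
move=> sKH sQP [cHH expH]; split=> [/cHH cHHP | x Kx].
  exact: subset_trans (commgSS sKH sKH) (subset_trans cHHP (centS sQP)).
exact: subsetP (centS sQP) _ (expH x (subsetP sKH x Kx)).
Qed.

Lemma exponent_actionJ (gT : finGroupType) (ab : bool) (p : nat)
    (H P : {set gT}) (g : gT) :
  exponent_action ab p H P -> exponent_action ab p (H :^ g) (P :^ g).
Proof.
case=> cHH expH; split=> [/cHH cHHP | _ /imsetP[x Hx ->]].
  by rewrite -conjsRg centJ conjSg.
by rewrite -conjXg centJ memJ_conjg expH.
Qed.

Lemma exponent_action_quotient (gT : finGroupType) (ab : bool) (p : nat)
    (H P N : {group gT}) :
    H \subset 'N(N) -> P \subset 'N(N) ->
  exponent_action ab p H P -> exponent_action ab p (H / N) (P / N).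
Proof.
move=> nNH nNP [cHH expH]; split=> [/cHH cHHP | _ /morphimP[x Nx Hx ->]].
  by rewrite -quotientR // quotient_cents.
apply/centP=> _ /morphimP[y Ny Py ->].
rewrite /commute -morphX // -!morphM ?groupX //.
by rewrite (centP (expH x Hx)).
Qed.

Lemma exponent_action_comm (gT : finGroupType) (ab : bool) (p : nat)
    (H P : {group gT}) :
  abelian H -> exponent_action false p H P -> exponent_action ab p H P.
Proof.
by move=> /commG1P cHH [_ expH]; split=> // _; rewrite cHH sub1G.
Qed.

(** D centralises P / N, and by coprimeness the fixed points of D in P / N lift
    to fixed points in P. *)
Lemma coprime_mulg_cent (gT : finGroupType) (P N D : {group gT}) :
    solvable P -> coprime #|P| #|D| -> N <| P -> D \subset 'N(N) ->
    [~: P, D] \subset N ->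
  N * 'C_P(D) = P.
Proof.
move=> solP coPD /andP[sNP nNP] nND sPDN.
have nNC : 'C_P(D) \subset 'N(N) by rewrite subIset ?nNP.
have := coprime_quotient_cent sNP nND coPD solP.
have cPDN : P / N \subset 'C(D / N) by rewrite quotient_cents2.
rewrite (setIidPl cPDN).
move/(congr1 (fun X => coset N @*^-1 X)).
by rewrite /= (@quotientGK _ N P) ?/(_ <| _) ?sNP // quotientK.
Qed.

Lemma coprime_cent_chain (gT : finGroupType) (P N D : {group gT}) :
    solvable P -> coprime #|P| #|D| -> N <| P -> D \subset 'N(N) ->
    [~: P, D] \subset N -> D \subset 'C(N) ->
  D \subset 'C(P).
Proof.
move=> solP coPD nsNP nND sPDN cND.
rewrite centsC -(coprime_mulg_cent solP coPD nsNP nND sPDN).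
by rewrite mul_subG ?subsetIr // centsC.
Qed.

Lemma coprime_cent_Frattini (gT : finGroupType) (P D : {group gT}) :
    solvable P -> coprime #|P| #|D| -> D \subset 'N(P) ->
    [~: P, D] \subset 'Phi(P) ->
  D \subset 'C(P).
Proof.
move=> solP coPD nPD sPDN.
have nND : D \subset 'N('Phi(P)) by rewrite gFnorm_trans.
have eqP := coprime_mulg_cent solP coPD (Phi_normal P) nND sPDN.
have nFC : 'C_P(D) \subset 'N('Phi(P)) by rewrite subIset ?gFnorm.
have joinP : 'Phi(P) <*> 'C_P(D) = P by rewrite /= norm_joinEr.
have genP := Phi_nongen joinP; rewrite genGid in genP.
by rewrite centsC -genP subsetIr.
Qed.

(** The condition on H amounts to a few subgroups D of H centralising P, so any
    centralisation criterion valid for all subgroups D of H carries over. *)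
Lemma exponent_action_lift (gT : finGroupType) (ab : bool) (p : nat)
    (H P N Q : {group gT}) :
    H \subset 'N(N) ->
    (forall D : {group gT}, D \subset H -> D / N \subset 'C(P / N) ->
       D \subset 'C(Q) -> D \subset 'C(P)) ->
    exponent_action ab p H Q -> exponent_action ab p (H / N) (P / N) ->
  exponent_action ab p H P.
Proof.
move=> nNH lift [cHHQ expHQ] [cHHP expHP]; split=> [ab_true | x Hx].
  apply: (lift [~: H, H]%G); last exact: cHHQ.
    by rewrite commg_subr normG.
  by rewrite /= quotientR ?cHHP.
have Nx : x \in 'N(N) by apply: subsetP Hx.
rewrite -cycle_subG; apply: (lift <[x ^+ p.-1]>%G).
- by rewrite cycle_subG groupX.
- by rewrite quotient_cycle ?groupX // cycle_subG morphX // expHP ?mem_quotient.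
- by rewrite cycle_subG expHQ.
Qed.

Lemma exponent_action_Frattini (gT : finGroupType) (ab : bool) (p : nat)
    (H P : {group gT}) :
    p.-group P -> p^'.-group H -> H \subset 'N(P) ->
    exponent_action ab p (H / 'Phi(P)) (P / 'Phi(P)) ->
  exponent_action ab p H P.
Proof.
move=> pP p'H nPH; have nFH : H \subset 'N('Phi(P)) by rewrite gFnorm_trans.
(* The action on P / Phi(P) suffices: Q = 1 makes the other condition void. *)
apply: (exponent_action_lift (Q := 1%G)) => // [D sDH cDP _|].
  apply: coprime_cent_Frattini => //.
  - exact: pgroup_sol pP.
  - exact: pnat_coprime pP (pgroupS sDH p'H).
  - exact: subset_trans sDH nPH.
  by rewrite commGC -quotient_cents2 ?gFnorm // (subset_trans sDH nFH).
by split=> [_ | x _]; rewrite cent1T ?subsetT ?inE.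
Qed.

Lemma exponent_action_extension (gT : finGroupType) (ab : bool) (p : nat)
    (H P N : {group gT}) :
    p.-group P -> p^'.-group H -> N <| P -> H \subset 'N(N) ->
    exponent_action ab p H N -> exponent_action ab p (H / N) (P / N) ->
  exponent_action ab p H P.
Proof.
move=> pP p'H nsNP nNH; apply: exponent_action_lift => // D sDH cDP cDN.
have nND := subset_trans sDH nNH.
apply: (coprime_cent_chain (pgroup_sol pP) _ nsNP) => //.
  exact: pnat_coprime pP (pgroupS sDH p'H).
by rewrite commGC -quotient_cents2 // normal_norm.
Qed.

(** * Scalar actions *)

Definition normalizes_subgroups (gT : finGroupType) (Y V : {set gT}) : Prop :=
  forall U : {group gT}, U \subset V -> Y \subset 'N(U).

(** An operator on a vector space that preserves all lines is a scalar: compare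
    the factors by which it multiplies v, w and v + w for independent v and w.
*)
Lemma scalar_action (gT : finGroupType) (p : nat) (V : {group gT}) (y : gT) :
    prime p -> p.-abelem V -> normalizes_subgroups [set y] V ->
  exists k, {in V, forall v, v ^ y = v ^+ k}.
Proof.
move=> pr_p abelV nVy.
have [abV expV] := abelemP pr_p abelV.
have pow v : v \in V -> exists m, v ^ y = v ^+ m.
  move=> Vv; apply/cycleP; rewrite memJ_norm ?cycle_id //.
  by rewrite -sub1set nVy ?cycle_subG.
have [-> | /trivgPn[v Vv ntv]] := eqVneq (V : {set gT}) 1.
  by exists 0%N => _ /set1P->; rewrite conj1g.
have [k Dk] := pow v Vv; exists k => w Vw.
have [/cycleP[i ->] | notvw] := boolP (w \in <[v]>).
  by rewrite conjXg Dk -!expgM mulnC.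
have tiWV : <[w]> :&: <[v]> = 1.
  apply: prime_TIg; last by rewrite cycle_subG.
  rewrite -/#[w] (abelem_order_p abelV) //.
  by apply: contraNneq notvw => ->; apply: group1.
have [l Dl] := pow w Vw; have [m Dm] := pow (v * w) (groupM Vv Vw).
have cvw : commute v w by apply: (centsP abV).
have eqvw : v ^+ k * w ^+ l = v ^+ m * w ^+ m.
  by rewrite -expgMn // -Dm conjMg Dk Dl.
have eq1 : w ^+ l * (w ^+ m)^-1 = (v ^+ k)^-1 * v ^+ m.
  by apply: (mulgI (v ^+ k)); rewrite mulgA eqvw mulgK mulKVg.
have w1 : w ^+ l * (w ^+ m)^-1 = 1.
  apply/set1P; rewrite -[[set 1]]tiWV inE {2}eq1.
  by rewrite !groupM ?groupV ?mem_cycle.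
have -> : w ^ y = w ^+ m.
  by rewrite Dl -(mulgKV (w ^+ m) (w ^+ l)) w1 mul1g.
have /eqP: v ^+ k = v ^+ m.
  by rewrite -(mulKVg (v ^+ k) (v ^+ m)) -eq1 w1 mulg1.
rewrite eq_expg_mod_order (abelem_order_p abelV) // => /eqP eqkm.
by apply/eqP; rewrite -(expg_mod m (expV w Vw)) -eqkm (expg_mod k (expV w Vw)).
Qed.

(** Scalars commute with every linear operator and have order dividing p - 1 by
    Fermat's little theorem. *)
Lemma scalar_action_cent (gT : finGroupType) (p : nat) (V Y : {group gT})
    (x y : gT) :
    prime p -> p.-abelem V -> normalizes_subgroups Y V -> y \in Y ->
  y ^+ p.-1 \in 'C(V) /\ (x \in 'N(V) -> [~ x, y] \in 'C(V)).
Proof.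
move=> pr_p abelV nVY Yy; have [abV expV] := abelemP pr_p abelV.
have [|k Dk] := @scalar_action _ p V y pr_p abelV.
  by move=> U sUV; apply: subset_trans (nVY U sUV); rewrite sub1set.
have nVy : y \in 'N(V) by apply: subsetP Yy; apply: nVY.
split=> [|nVx].
  apply/centP=> v Vv; apply/commute_sym/commgP/conjg_fixP.
  have Dkn n : v ^ (y ^+ n) = v ^+ (k ^ n).
    elim: n => [|n IHn]; first by rewrite conjg1 expg1.
    by rewrite expgSr conjgM IHn conjXg Dk // -expgM expnS.
  have [-> | ntv] := eqVneq v 1; first by rewrite conj1g.
  have ov := abelem_order_p abelV Vv ntv.
  have co_k : coprime k p.
    rewrite coprime_sym prime_coprime // -ov order_dvdn -Dk //.
    by rewrite conjg_eq1.
  have := Euler_exp_totient co_k; rewrite totient_prime // => eq1.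
  by rewrite Dkn -(expg_mod _ (expV v Vv)) eq1 expg_mod ?expV.
apply/centP=> v Vv; apply/commute_sym/commgP/conjg_fixP.
have Vu : v ^ x^-1 \in V by rewrite memJ_norm ?groupV.
have Vw : (v ^ x^-1) ^ y^-1 \in V by rewrite memJ_norm ?groupV.
set w := (v ^ x^-1) ^ y^-1 in Vw.
have -> : v ^ [~ x, y] = (w ^ x) ^ y.
  by rewrite -!conjgM commgEl conjgE !mulgA.
have Vwx : w ^ x \in V by rewrite memJ_norm.
by rewrite Dk // -conjXg -Dk // !conjgKV.
Qed.

Lemma exponent_action_scalar (gT : finGroupType) (ab : bool) (p : nat)
    (V Y : {group gT}) :
    prime p -> p.-abelem V -> normalizes_subgroups Y V ->
  exponent_action ab p Y V.
Proof.
move=> pr_p abelV nVY; split=> [_ | y Yy].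
  rewrite gen_subG; apply/subsetP=> _ /imset2P[x y Yx Yy ->].
  have [_ ->] // := scalar_action_cent x pr_p abelV nVY Yy.
  by apply: subsetP Yx; apply: nVY.
by have [] := scalar_action_cent 1 pr_p abelV nVY Yy.
Qed.

(** Adjoining scalars Y to the operators X changes neither commutativity nor
    the bound on the exponent. *)
Lemma exponent_action_scalar_mul (gT : finGroupType) (ab : bool) (p : nat)
    (V X Y : {group gT}) :
    prime p -> p.-abelem V -> X \subset 'N(V) -> exponent_action ab p X V ->
    normalizes_subgroups Y V ->
  exponent_action ab p (X <*> Y) V.
Proof.
move=> pr_p abelV nVX [cXX expX] nVY; have nVY' : Y \subset 'N(V) by apply: nVY.
have [cYY expY] := exponent_action_scalar true pr_p abelV nVY.
have nVXY : X <*> Y \subset 'N(V) by rewrite join_subG nVX.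
have nCV : 'N(V) \subset 'N('C(V)) by apply: cent_norm.
(* Working modulo C(V) turns the action into a group, where powers of products
   of commuting elements can be computed. *)
have cXY : Y / 'C(V) \subset 'C(X / 'C(V)).
  rewrite quotient_cents2 ?(subset_trans _ nCV) //.
  rewrite gen_subG; apply/subsetP=> _ /imset2P[y x Yy Xx ->].
  rewrite -groupV invg_comm.
  have [_ ->] // := scalar_action_cent x pr_p abelV nVY Yy.
  exact: subsetP Xx.
have eqXY : (X <*> Y) / 'C(V) = (X / 'C(V)) * (Y / 'C(V)).
  rewrite quotientY ?(subset_trans _ nCV) // cent_joinEr //.
split=> [/cXX cXXV | z XYz].
  rewrite -quotient_cents2 ?(subset_trans _ nCV) // eqXY.
  rewrite -/(abelian _) abelianM /abelian cXY.
  by rewrite !quotient_cents2 ?(subset_trans _ nCV) ?cXXV ?cYY.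
have cos1 (U : {set gT}) u : U \subset 'N(V) -> exponent_action ab p U V ->
    u \in U / 'C(V) -> u ^+ p.-1 = 1.
  move=> nVU [_ expU] /morphimP[x Nx Ux ->].
  by rewrite -morphX //= coset_id ?expU.
have nCz : z \in 'N('C(V)) by apply: subsetP (subset_trans nVXY nCV) z XYz.
apply: coset_idr; first by rewrite groupX.
have : coset 'C(V) z \in (X <*> Y) / 'C(V) by rewrite mem_quotient.
rewrite eqXY morphX //= => /mulsgP[x y Xx Yy ->].
have cxy : commute x y by apply/esym/(centsP cXY).
rewrite expgMn // (cos1 X x) // (cos1 Y y) ?mulg1 //.
exact: exponent_action_scalar.
Qed.

(** * P-subnormality and actions of exponent dividing p - 1 *)

(** Intersecting the chain from C to G with P yields a C-invariant chain from 1
    to P with successive indices 1 or p. On a factor of order p every operator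
    is a scalar, and as C is a p'-group the conditions propagate up the chain.
*)
Lemma P_subnormal_exponent_action (gT : finGroupType) (p : nat)
    (G P C : {group gT}) :
    prime p -> p.-group P -> P <| G -> p^'.-group C -> P_subnormal C G ->
  exponent_action true p C P.
Proof.
move=> pr_p pP nsPG p'C snC.
suff [_] : C \subset G /\ exponent_action true p C (G :&: P).
  by rewrite (setIidPr (normal_sub nsPG)).
apply: (P_subnormal_ind
  (Q := fun K => C \subset K /\ exponent_action true p C (K :&: P))) snC.
  move=> L K sLK sKG pr_r [sCL exCL]; have sCK := subset_trans sCL sLK.
  split=> //.
  have nsPK : K :&: P <| K by rewrite (normalGI sKG).
  have nsPL : L :&: P <| L by rewrite (normalGI (subset_trans sLK sKG)).
  have sPLK : L :&: P \subset K :&: P by rewrite setSI.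
  have pPK : p.-group (K :&: P) by apply: pgroupS (subsetIr K P) pP.
  have dvd_r : #|K :&: P : L :&: P| %| #|K : L|.
    have -> : L :&: P = (K :&: P) :&: L.
      by rewrite setIAC (setIidPr sLK).
    rewrite indexgI -indexMg -norm_joinEl.
      rewrite -(@Lagrange_index _ K (L <*> (K :&: P)) L) ?dvdn_mull //.
        by rewrite join_subG sLK normal_sub.
      exact: joing_subl.
    exact: subset_trans sLK (normal_norm nsPK).
  have [eq1 | ne1] := eqVneq #|K :&: P : L :&: P| 1%N.
    suff -> : K :&: P = L :&: P by [].
    by apply/eqP; rewrite eqEsubset sPLK -indexg_eq1 eq1 eqxx.
  have Dp : #|K :&: P : L :&: P| = p.
    have p_ix : p.-nat #|K :&: P : L :&: P| := pnat_dvd (dvdn_indexg _ _) pPK.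
    have /primeP[_ r_div] := pr_r.
    have /orP[|/eqP Dr] := r_div _ dvd_r; first by rewrite (negPf ne1).
    by move: p_ix; rewrite Dr pnatE // => /eqP.
  have nsPLK : L :&: P <| K :&: P.
    by apply: p_maximal_normal pPK _; rewrite p_index_maximal ?Dp.
  have oV : #|(K :&: P) / (L :&: P)| = p by rewrite card_quotient ?normal_norm.
  have nPLC : C \subset 'N(L :&: P) := subset_trans sCL (normal_norm nsPL).
  have nPKC : C \subset 'N(K :&: P) := subset_trans sCK (normal_norm nsPK).
  apply: (exponent_action_extension pPK p'C nsPLK nPLC exCL).
  apply: exponent_action_scalar => //; first exact: prime_abelem oV.
  move=> U sUV; have [-> | ntU] := eqsVneq U 1; first by rewrite norm1 subsetT.
  have -> : U :=: (K :&: P) / (L :&: P).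
    apply/eqP; rewrite eqEsubset sUV prime_meetG ?oV //.
    by rewrite (setIidPr sUV).
  exact: quotient_norms.
split=> //; have -> : C :&: P = 1.
  by rewrite setIC coprime_TIg // (pnat_coprime pP).
by split=> [_ | x _]; rewrite cent1T ?subsetT ?inE.
Qed.

(** The operator x satisfies X^p - X, which splits into distinct linear factors
    over the field with p elements. *)
Lemma exists_eigenvector (gT : finGroupType) (p : nat) (V : {group gT})
    (x : gT) :
    prime p -> p.-abelem V -> V :!=: 1 -> x \in 'N(V) -> x ^+ p.-1 \in 'C(V) ->
  exists k, exists2 v, v \in V^# & v ^ x = v ^+ k.
Proof.
move=> pr_p abelV ntV0 nVx cVx.
have nVX : <[x]> \subset 'N(V) by rewrite cycle_subG.
pose A := abelem_repr abelV ntV0 nVX x.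
have A1 : (A ^+ p.-1)%R = 1%:M%R.
  have kerx : x ^+ p.-1 \in rker (abelem_repr abelV ntV0 nVX).
    by rewrite rker_abelem inE cVx andbT mem_cycle.
  by have /rkerP[_ <-] := kerx; rewrite -repr_mxX ?cycle_id.
have [a /eigenvalueP[v Dv ntv]] : exists a, eigenvalue A a.
  have eqX : horner_mx A ('X^p - 'X)%R = 0%R.
    have Ap : (A ^+ p.-1.+1 = A)%R by rewrite GRing.exprS A1 GRing.mulr1.
    rewrite prednK ?prime_gt0 // in Ap.
    by rewrite GRing.rmorphB /= GRing.rmorphXn /= horner_mx_X Ap GRing.subrr.
  have genX := finField_genPoly 'F_p; rewrite card_Fp // in genX.
  have := mxminpoly_min eqX; rewrite genX.
  case/dvdp_prod_XsubC=> m; case Dm: (mask m _) => [|a s] eqm.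
    (* No linear factor at all would make the minimal polynomial constant. *)
    have := eqp_size eqm; rewrite big_nil size_polyC GRing.oner_neq0.
    by rewrite size_mxminpoly => -[deg0]; have := mxminpoly_nonconstant A;
       rewrite deg0.
  exists a; rewrite eigenvalue_root_min (eqp_root eqm) big_cons.
  by rewrite rootM root_XsubC eqxx.
exists a; exists (rVabelem abelV ntV0 v); last first.
  by rewrite -(rVabelemJ abelV ntV0 nVX) ?cycle_id // -rVabelemZ -Dv.
rewrite !inE mem_rVabelem andbT; apply: contraNneq ntv => v1.
by apply/eqP/(rVabelem_inj abelV ntV0); rewrite v1 rVabelem0.
Qed.

(** Simultaneous diagonalisation: on a minimal L-invariant subgroup M, an
    eigenspace of an element of L is L-invariant because L acts as an abelian
    group, so it is all of M. Then every line of M is invariant. *)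
Lemma exponent_action_invariant_order_p (gT : finGroupType) (p : nat)
    (V L : {group gT}) :
    prime p -> p.-abelem V -> V :!=: 1 -> L \subset 'N(V) ->
    exponent_action true p L V ->
  exists N : {group gT}, [/\ N \subset V, #|N| = p & L \subset 'N(N)].
Proof.
move=> pr_p abelV ntV nVL [/(_ isT) cLL expL].
have [M minM sMV] := minnormal_exists ntV nVL.
have [/andP[ntM nML] minM'] := mingroupP minM.
have abelM := abelemS sMV abelV; have [abM expM] := abelemP pr_p abelM.
have scal x : x \in L -> exists k, {in M, forall u, u ^ x = u ^+ k}.
  move=> Lx; have nMx : x \in 'N(M) by apply: subsetP Lx.
  have cMx : x ^+ p.-1 \in 'C(M) := subsetP (centS sMV) _ (expL x Lx).
  have [k [v /setD1P[ntv Mv] Dv]] := exists_eigenvector pr_p abelM ntM nMx cMx.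
  exists k; pose E := [set u in M | u ^ x == u ^+ k].
  have gE : group_set E.
    apply/group_setP; split=> [|u w].
      by rewrite inE group1 conj1g expg1n /=.
    rewrite !inE => /andP[Mu /eqP Du] /andP[Mw /eqP Dw]; rewrite groupM //=.
    by rewrite conjMg Du Dw expgMn //; apply: (centsP abM).
  have sEM : Group gE \subset M by apply/subsetP=> u; rewrite inE => /andP[].
  have Ev : v \in Group gE by rewrite inE Mv Dv /=.
  have EM : Group gE :=: M.
    apply: minM' => //; apply/andP; split.
      by apply/trivgPn; exists v.
    apply/subsetP=> y Ly; rewrite inE; apply/subsetP=> _ /imsetP[u Eu ->].
    move: Eu; rewrite !inE => /andP[Mu /eqP Du].
    have Muy : u ^ y \in M by rewrite memJ_norm ?(subsetP nML).
    have Muxy : u ^ (x * y) \in M by rewrite memJ_norm ?(subsetP nML) ?groupM.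
    have cyx : [~ y, x] \in 'C(V) by apply: subsetP cLL _ (mem_commg Ly Lx).
    rewrite Muy /= -conjgM.
    have -> : y * x = x * y * [~ y, x] by rewrite -commgC.
    have -> : (u ^ y) ^+ k = u ^ (x * y) by rewrite -conjXg -Du conjgM.
    rewrite conjgM; apply/eqP/conjg_fixP/commgP.
    exact/commute_sym/(centP cyx)/(subsetP sMV).
  by move=> u; rewrite -EM inE => /andP[_ /eqP].
have [v Mv ntv] := trivgPn _ ntM.
exists <[v]>%G; split.
- by rewrite cycle_subG (subsetP sMV).
- exact: abelem_order_p abelM Mv ntv.
apply/subsetP=> x Lx; have [k Dk] := scal x Lx.
by rewrite inE -cycleJ cycle_subG Dk ?mem_cycle.
Qed.

(** Starting from R, each step goes up by a factor p: the nontrivial p-group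
    N_P(R) / R has a nontrivial elementary abelian L-invariant subgroup
    Ohm_1(Z(N_P(R) / R)), which contains an L-invariant subgroup of order p.
    Allowing R <> 1 covers subgroups of LP that are not p'-groups. *)
Lemma P_subnormal_joinG (gT : finGroupType) (p : nat) (L P R : {group gT}) :
    prime p -> p.-group P -> p^'.-group L -> L \subset 'N(P) ->
    exponent_action true p L P -> R \subset P -> L \subset 'N(R) ->
  P_subnormal (L <*> R)%G (L <*> P)%G.
Proof.
move=> pr_p pP p'L nPL exL.
have [n] := ubnP (#|P| - #|R|); elim: n R => // n IHn R ltn sRP nRL.
have [eqRP | neRP] := eqVneq (R : {set gT}) P.
  by rewrite (group_inj eqRP); apply: P_subnormal_refl.
have prRP : R \proper P by rewrite properEneq neRP.
have pr := nilpotent_proper_norm (pgroup_nil pP) prRP.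
set N := 'N_P(R)%G in pr.
have nRN : N \subset 'N(R) by apply: subsetIr.
have nsRN : R <| N by rewrite /normal proper_sub.
have sNP : N \subset P by apply: subsetIl.
have pNR : p.-group (N / R) by rewrite quotient_pgroup ?(pgroupS sNP).
pose Z := 'Ohm_1('Z(N / R))%G.
have pZ : p.-group 'Z(N / R) by apply: pgroupS (center_sub _) pNR.
have abelZ : p.-abelem Z by apply: Ohm1_abelem (center_abelian _).
have ntZ : Z :!=: 1.
  by rewrite /= Ohm1_eq1 center_nil_eq1 ?(pgroup_nil pNR) // quotient_neq1.
have sZN : Z \subset N / R := subset_trans (Ohm_sub 1 _) (center_sub _).
have nNL : L \subset 'N(N) by rewrite normsI ?norms_norm.
have nZL : L / R \subset 'N(Z).
  by rewrite !gFnorm_trans // quotient_norms.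
have exZ : exponent_action true p (L / R) Z.
  apply: (exponent_actionS (subxx _) sZN).
  exact: exponent_action_quotient (exponent_actionS (subxx _) sNP exL).
have [W [sWZ oW nWL]] :=
  exponent_action_invariant_order_p pr_p abelZ ntZ nZL exZ.
pose R1 := (coset R @*^-1 W)%G.
have sRR1 : R \subset R1 := sub_cosetpre W.
have sR1P : R1 \subset P.
  apply: subset_trans sNP; rewrite -(quotientGK nsRN) morphpreS //.
  exact: subset_trans sWZ sZN.
have nR1L : L \subset 'N(R1) by apply: norm_quotient_pre.
have oR1 : #|R1 : R| = p.
  by rewrite -oW -(cosetpreK W) card_quotient // subsetIl.
have oLJ (J : {group gT}) : J \subset P -> L \subset 'N(J) ->
    #|L <*> J| = (#|L| * #|J|)%N.
  move=> sJP nJL; rewrite norm_joinEl ?TI_cardMg // setIC coprime_TIg //.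
  exact: pnat_coprime (pgroupS sJP pP) p'L.
have ltR : (#|R| < #|R1|)%N.
  by rewrite -(Lagrange sRR1) oR1 ltn_Pmulr ?prime_gt1.
apply: (@P_subnormal_trans _ (L <*> R1)%G); last first.
  apply: IHn => //; rewrite -ltnS; apply: leq_trans ltn; rewrite ltnS.
  by apply: ltn_sub2l => //; apply: leq_trans ltR (subset_leq_card sR1P).
apply: (P_subnormal_step pr_p); first by rewrite genS ?setUS.
rewrite -(@dvdn_pmul2l #|L <*> R|) ?cardG_gt0 // Lagrange ?genS ?setUS //.
by rewrite !oLJ // -(Lagrange sRR1) oR1 mulnA.
Qed.

(** * Mutually permutable subgroups and products *)

(** Since P permutes with all subgroups R of Q, the subgroups PR link P to PQ
    by steps of index q, so P lies in O = O_p(PQ). For a subgroup U of P, the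
    modular law gives U = UQ :&: O, and Q normalises both UQ and O. *)
Lemma mutually_permutable_normalizes (gT : finGroupType) (p q : nat)
    (P Q : {group gT}) :
    prime p -> prime q -> q < p -> p.-group P -> q.-group Q ->
    mutually_permutable P Q ->
  normalizes_subgroups Q P.
Proof.
move=> pr_p pr_q ltqp pP qQ [permP permQ].
have snP (R : {group gT}) : R \subset Q -> P_subnormal P (P <*> R)%G.
  have [n] := ubnP #|R|; elim: n R => // n IHn R ltn sRQ.
  have [eqR1 | [M maxM _]] := maximal_exists (sub1G R).
    have -> : (P <*> R)%G = P by apply: group_inj; rewrite /= -eqR1 joingG1.
    exact: P_subnormal_refl.
  have [sMR _] := andP (maxgroupp maxM).
  have sMQ := subset_trans sMR sRQ.
  apply: (@P_subnormal_trans _ (P <*> M)%G).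
    by apply: IHn => //; apply: leq_trans (proper_card (maxgroupp maxM)) _.
  have ixM := p_maximal_index (pgroupS sRQ qQ) maxM.
  apply: (P_subnormal_step pr_q); first by rewrite genS ?setUS.
  have -> : (P <*> R)%G = (P <*> M) * R :> {set gT}.
    rewrite /= !comm_joingE; try exact: permQ.
    by rewrite -mulgA (mulSGid sMR).
  rewrite indexMg -ixM -indexgI; apply: indexgS.
  by rewrite subsetI sMR joing_subr.
set O := 'O_p(P <*> Q)%G.
have sPO : P \subset O.
  apply: P_subnormal_sub_pcore (snP Q (subxx Q)) => // r.
  rewrite mem_primes => /and3P[pr_r _].
  rewrite /= comm_joingE; last exact: permP.
  move=> r_dv; have: r %| #|P| * #|Q| by rewrite mul_cardG dvdn_mulr.
  rewrite Euclid_dvdM // => /orP[] r_dvd.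
    by have /eqP-> := pgroupP pP r pr_r r_dvd.
  by have /eqP-> := pgroupP qQ r pr_r r_dvd; apply: ltnW.
move=> U sUP; have sUO := subset_trans sUP sPO.
have -> : U :=: (U <*> Q) :&: O.
  rewrite /= comm_joingE; last exact: permP.
  rewrite -group_modl // [Q :&: O]setIC coprime_TIg ?mulg1 //.
  apply: pnat_coprime (pcore_pgroup p _) _.
  by apply: sub_in_pnat qQ => r _ /eqP->; rewrite !inE neq_ltn ltqp.
apply: normsI; first exact: subset_trans (joing_subr U Q) (normG _).
exact: subset_trans (joing_subr P Q) (gFnorm _ _).
Qed.

(** The conjugators that carry A1 and B1 into H can be corrected by elements of
    A and B so as to agree, since they differ by an element of AB. The orders
    then force the product of the two conjugates to be a full Hall subgroup.
    Conjugacy is a hypothesis in order to cover both a Sylow subgroup of an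
    arbitrary group and a Hall subgroup of a soluble one. *)
Lemma factorized_Hall (gT : finGroupType) (pi : nat_pred)
    (G A B H A1 B1 : {group gT}) :
    A * B = G -> pi.-Hall(G) H ->
    (forall X : {group gT}, X \subset G -> pi.-group X ->
       exists2 g, g \in G & X \subset H :^ g) ->
    pi.-Hall(A) A1 -> pi.-Hall(B) B1 ->
  exists A2 B2 K : {group gT},
    [/\ pi.-Hall(A) A2, pi.-Hall(B) B2, pi.-Hall(G) K & A2 * B2 = K].
Proof.
move=> defG hallH subJ hallA hallB.
have sAG : A \subset G by rewrite -defG mulG_subl.
have sBG : B \subset G by rewrite -defG mulG_subr.
have [g1 Gg1 sA1] : exists2 g, g \in G & A1 \subset H :^ g.
  exact: subJ (subset_trans (pHall_sub hallA) sAG) (pHall_pgroup hallA).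
have [g2 Gg2 sB1] : exists2 g, g \in G & B1 \subset H :^ g.
  exact: subJ (subset_trans (pHall_sub hallB) sBG) (pHall_pgroup hallB).
have : g1^-1 * g2 \in A * B by rewrite defG groupM ?groupV.
case/mulsgP=> a b Aa Bb Dab.
have hallA2 : pi.-Hall(A) (A1 :^ a) by rewrite pHallJ.
have hallB2 : pi.-Hall(B) (B1 :^ b^-1) by rewrite pHallJ ?groupV.
have hallK : pi.-Hall(G) (H :^ (g1 * a)).
  by rewrite pHallJ // groupM // (subsetP sAG).
exists (A1 :^ a)%G, (B1 :^ b^-1)%G, (H :^ (g1 * a))%G; split=> //.
have sAK : A1 :^ a \subset H :^ (g1 * a) by rewrite conjsgM conjSg.
have sBK : B1 :^ b^-1 \subset H :^ (g1 * a).
  have -> : g1 * a = g2 * b^-1.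
    by rewrite -[a](mulgK b) -Dab !mulgA mulgV mul1g.
  by rewrite conjsgM conjSg.
apply/eqP; rewrite eqEcard mul_subG //=.
rewrite -(leq_pmul2r (cardG_gt0 (A1 :^ a :&: B1 :^ b^-1)%G)) -mul_cardG.
rewrite (card_Hall hallA2) (card_Hall hallB2) (card_Hall hallK) -partnM //.
rewrite mul_cardG defG partnM ?cardG_gt0 // leq_pmul2l ?part_gt0 //.
apply: dvdn_leq; first exact: part_gt0.
rewrite -(part_pnat_id (pgroupS (subsetIl _ _) (pHall_pgroup hallA2))).
apply: partn_dvd; rewrite ?cardG_gt0 // cardSg // setISS //.
  exact: pHall_sub hallA2.
exact: pHall_sub hallB2.
Qed.

Lemma normalizes_subgroups_quotient (gT : finGroupType) (Y V N : {group gT}) :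
    Y \subset 'N(N) -> V \subset 'N(N) ->
  normalizes_subgroups Y V -> normalizes_subgroups (Y / N) (V / N).
Proof.
move=> nNY nNV nVY U sUV.
have -> : U :=: (V :&: coset N @*^-1 U) / N.
  by rewrite /quotient morphim_setIpre (setIidPr _).
by rewrite quotient_norms // nVY ?subsetIl.
Qed.

(** Modulo Phi(P) the factors A and B become elementary abelian; on the image
    of A the group Y acts by scalars, and on that of B the group X does. *)
Lemma exponent_action_mul (gT : finGroupType) (ab : bool) (p : nat)
    (A B P X Y : {group gT}) :
    prime p -> p.-group P -> A * B = P -> p^'.-group (X <*> Y) ->
    X \subset 'N(A) -> exponent_action ab p X A -> normalizes_subgroups Y A ->
    Y \subset 'N(B) -> exponent_action ab p Y B -> normalizes_subgroups X B ->
  exponent_action ab p (X <*> Y) P.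
Proof.
move=> pr_p pP defP p'XY nAX exX nAY nBY exY nBX.
have nAY' : Y \subset 'N(A) by apply: nAY.
have nBX' : X \subset 'N(B) by apply: nBX.
have nPX : X \subset 'N(P) by rewrite -defP normsM.
have nPY : Y \subset 'N(P) by rewrite -defP normsM.
have nPXY : X <*> Y \subset 'N(P) by rewrite join_subG nPX.
have sAP : A \subset P by rewrite -defP mulG_subl.
have sBP : B \subset P by rewrite -defP mulG_subr.
set F := 'Phi(P)%G.
have nFP : P \subset 'N(F) by apply: gFnorm.
have nFX : X \subset 'N(F) by apply: gFnorm_trans.
have nFY : Y \subset 'N(F) by apply: gFnorm_trans.
have nFA := subset_trans sAP nFP; have nFB := subset_trans sBP nFP.
have abelP : p.-abelem (P / F) by apply: Phi_quotient_abelem.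
have abelJ (J : {group gT}) : J \subset P -> p.-abelem (J / F).
  by move=> sJP; apply: abelemS abelP; apply: quotientS.
apply: exponent_action_Frattini => //.
have exA : exponent_action ab p ((X <*> Y) / F) (A / F).
  rewrite quotientY //; apply: exponent_action_scalar_mul => //.
  - exact: abelJ.
  - exact: quotient_norms.
  - exact: exponent_action_quotient.
  - exact: normalizes_subgroups_quotient.
have exB : exponent_action ab p ((X <*> Y) / F) (B / F).
  rewrite quotientY // joingC; apply: exponent_action_scalar_mul => //.
  - exact: abelJ.
  - exact: quotient_norms.
  - exact: exponent_action_quotient.
  - exact: normalizes_subgroups_quotient.
have -> : P / 'Phi(P) = (A / F) * (B / F) by rewrite -quotientMl ?defP.
case: exA exB => [cA eA] [cB eB]; split=> [abT | x XYx]; rewrite centM.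
  by rewrite subsetI cA ?cB.
by rewrite inE eA ?eB.
Qed.

Lemma p'group_normalizes_subgroups (gT : finGroupType) (p : nat)
    (A X V : {group gT}) :
    (forall (q : nat) (Q : {group gT}), prime q -> q != p -> q.-Sylow(A) Q ->
       normalizes_subgroups Q V) ->
    X \subset A -> p^'.-group X ->
  normalizes_subgroups X V.
Proof.
move=> nV sXA p'X U sUV; rewrite -(Sylow_gen X) gen_subG.
apply/bigcupsP=> S /SylowP[q pr_q sylS].
have sSA := subset_trans (pHall_sub sylS) sXA.
have [T sylT sST] := Sylow_superset sSA (pHall_pgroup sylS).
have [qp | neqp] := eqVneq q p.
  suff -> : S :=: 1 by rewrite sub1G.
  apply/eqP; rewrite trivg_card1; apply/eqP.
  apply: (@pnat_1 p); first by rewrite -qp; apply: pHall_pgroup sylS.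
  exact: pgroupS (pHall_sub sylS) p'X.
exact: subset_trans sST (nV q T pr_q neqp sylT U sUV).
Qed.

(** * The three classes *)

Lemma P_subnormal_quotient (gT : finGroupType) (H G N : {group gT}) :
  G \subset 'N(N) -> P_subnormal H G -> P_subnormal (H / N)%G (G / N)%G.
Proof.
move=> nNG; apply: (P_subnormal_ind
  (Q := fun K => P_subnormal (H / N)%G (K / N)%G));
  last exact: P_subnormal_refl.
move=> L K sLK sKG pr_r snH; apply: P_subnormal_trans snH _.
have nNK := subset_trans sKG nNG.
apply: (P_subnormal_step pr_r); first exact: quotientS.
(* L1 = K :&: LN has the same image as L and contains K :&: N, so that
   the index can be computed upstairs. *)
pose L1 := (K :&: coset N @*^-1 (L / N))%G.
have sLL1 : L \subset L1.
  by rewrite subsetI sLK /= quotientK ?mulG_subr // (subset_trans sLK).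
have -> : (L / N)%G = (L1 / N)%G.
  apply: group_inj; rewrite /= /quotient morphim_setIpre.
  by rewrite (setIidPr _) // morphimS.
rewrite index_quotient_eq ?subsetIl ?indexgS //.
by rewrite subsetI subsetIl subIset ?sub_cosetpre ?orbT.
Qed.

Lemma P_subnormal_cosetpre (gT : finGroupType) (N : {group gT})
    (H G : {group coset_of N}) :
  P_subnormal H G -> P_subnormal (coset N @*^-1 H)%G (coset N @*^-1 G)%G.
Proof.
apply: (P_subnormal_ind
  (Q := fun K => P_subnormal (coset N @*^-1 H)%G (coset N @*^-1 K)%G));
  last exact: P_subnormal_refl.
move=> L K sLK sKG pr_r snH; apply: P_subnormal_trans snH _.
by apply: (P_subnormal_step pr_r); rewrite ?morphpreS // index_cosetpre.
Qed.

Inductive subgroup_kind := Arbitrary | Sylow_subgroup | Primary_cyclic.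

Definition of_kind (k : subgroup_kind) (gT : finGroupType) (G H : {group gT}) :
    Prop :=
  match k with
  | Arbitrary => H \subset G
  | Sylow_subgroup => exists2 p, prime p & p.-Sylow(G) H
  | Primary_cyclic =>
      exists2 p, prime p & [/\ H \subset G, cyclic H & p.-group H]
  end.

Definition kind_P_subnormal (k : subgroup_kind) (gT : finGroupType)
    (G : {group gT}) : Prop :=
  forall H : {group gT}, of_kind k G H -> P_subnormal H G.

Lemma of_kind_sub k (gT : finGroupType) (G H : {group gT}) :
  of_kind k G H -> H \subset G.
Proof. by case: k => //= [[p _ /pHall_sub] | [p _ []]]. Qed.

Lemma of_kind_quotient k (gT : finGroupType) (G H N : {group gT}) :
  G \subset 'N(N) -> of_kind k G H -> of_kind k (G / N)%G (H / N)%G.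
Proof.
move=> nNG kH; have nNH := subset_trans (of_kind_sub kH) nNG.
case: k kH => /= [|[p pr_p sylH] | [p pr_p [sHG cycH pH]]].
- exact: quotientS.
- by exists p; rewrite ?quotient_pHall.
by exists p; rewrite ?quotientS ?quotient_cyclic ?quotient_pgroup.
Qed.

Lemma Sylow_quotient_lift (gT : finGroupType) (p : nat) (G N : {group gT})
    (Pb : {group coset_of N}) :
    G \subset 'N(N) -> p.-Sylow(G / N) Pb ->
  exists2 P : {group gT}, p.-Sylow(G) P & Pb = (P / N)%G.
Proof.
move=> nNG sylPb; have [S sylS] := Sylow_exists p G.
have sylSb := quotient_pHall (subset_trans (pHall_sub sylS) nNG) sylS.
have [_ /morphimP[x Nx Gx ->] DPb] := Sylow_trans sylSb sylPb.
exists (S :^ x)%G; first by rewrite pHallJ.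
by apply: group_inj; rewrite /= DPb quotientJ.
Qed.

Lemma of_kind_quotient_lift k (gT : finGroupType) (G N : {group gT})
    (Hb : {group coset_of N}) :
    G \subset 'N(N) -> of_kind k (G / N)%G Hb ->
  exists2 H : {group gT}, of_kind k G H & Hb = (H / N)%G.
Proof.
move=> nNG; case: k => /= [sHG | [p pr_p sylHb] | [p pr_p [sHG cycH pH]]].
- exists (G :&: coset N @*^-1 Hb)%G; first exact: subsetIl.
  by apply: group_inj; rewrite /= /quotient morphim_setIpre (setIidPr _).
- have [H sylH ->] := Sylow_quotient_lift nNG sylHb.
  by exists H => //; exists p.
have /cyclicP[yb Dyb] := cycH.
have : yb \in G / N by rewrite -cycle_subG -Dyb.
case/morphimP=> y Ny Gy Dy.
have py : p.-elt yb by rewrite /p_elt -/#[yb] /order -Dyb.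
exists <[y.`_p]>%G; last first.
  apply: group_inj; rewrite /= quotient_cycle ?groupX // Dyb.
  by rewrite morph_constt // -Dy constt_p_elt.
exists p => //; split; [by rewrite cycle_subG groupX | exact: cycle_cyclic |].
exact: p_elt_constt.
Qed.

Lemma kind_P_subnormal_quotient k (gT : finGroupType) (G N : {group gT}) :
  G \subset 'N(N) -> kind_P_subnormal k G -> kind_P_subnormal k (G / N)%G.
Proof.
move=> nNG snG Hb /(of_kind_quotient_lift nNG)[H kH ->].
by apply: P_subnormal_quotient => //; apply: snG.
Qed.

(** Each p-element belongs to a P-subnormal p-subgroup (a Sylow subgroup or the
    cyclic subgroup it generates), and hence to O_p(G). *)
Lemma kind_pcore_Sylow k (gT : finGroupType) (p : nat) (G : {group gT}) :
    prime p -> {in \pi(G), forall q, q <= p} -> kind_P_subnormal k G ->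
  p.-Sylow(G) 'O_p(G).
Proof.
move=> pr_p le_p snG; have [S sylS] := Sylow_exists p G.
have pS := pHall_pgroup sylS; have sSG := pHall_sub sylS.
suff sSO : S \subset 'O_p(G).
  suff -> : 'O_p(G) = S by [].
  by apply/eqP; rewrite eqEsubset sSO (pcore_sub_Hall sylS).
apply/subsetP=> x Sx.
have [X [kX pX Xx]] : exists X : {group gT},
    [/\ of_kind k G X, p.-group X & x \in X].
  case: k {snG} => /=.
  - by exists S.
  - by exists S; split=> //; exists p.
  exists <[x]>%G; rewrite cycle_id; have px : p.-group <[x]> := mem_p_elt pS Sx.
  by split=> //; exists p => //; rewrite cycle_subG (subsetP sSG) ?cycle_cyclic.
exact: subsetP (P_subnormal_sub_pcore pr_p le_p pX (snG X kX)) x Xx.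
Qed.

Lemma pi_le_max_pdiv (gT : finGroupType) (G H : {group gT}) :
  H \subset G -> {in \pi(H), forall q, q <= max_pdiv #|G|}.
Proof.
move=> sHG q; rewrite mem_primes => /and3P[pr_q _ q_dv].
by rewrite max_pdiv_max // mem_primes pr_q cardG_gt0 (dvdn_trans q_dv) ?cardSg.
Qed.

Lemma pcore_max_pdiv_neq1 (gT : finGroupType) (G : {group gT}) (p : nat) :
    p = max_pdiv #|G| -> G :!=: 1 -> p.-Sylow(G) 'O_p(G) -> 'O_p(G) != 1.
Proof.
move=> Dp ntG sylP; rewrite -cardG_gt1 (card_Hall sylP).
by rewrite p_part_gt1 Dp pi_max_pdiv cardG_gt1.
Qed.

Lemma kind_P_subnormal_sol k (gT : finGroupType) (G : {group gT}) :
  kind_P_subnormal k G -> solvable G.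
Proof.
have [n] := ubnP #|G|; elim: n gT G => // n IHn gT G ltn snG.
have [-> | ntG] := eqsVneq G 1; first exact: solvable1.
pose p := max_pdiv #|G|.
have pr_p : prime p by rewrite max_pdiv_prime ?cardG_gt1.
have sylP := kind_pcore_Sylow pr_p (pi_le_max_pdiv (subxx G)) snG.
rewrite (series_sol (pcore_normal p G)) (pgroup_sol (pcore_pgroup p G)) /=.
apply: IHn; last by apply: kind_P_subnormal_quotient snG; apply: gFnorm.
rewrite -ltnS; apply: leq_trans ltn; rewrite ltnS.
apply: ltn_quotient (pcore_sub p G).
exact: pcore_max_pdiv_neq1 sylP.
Qed.

(** P-subnormality of the cyclic subgroups bounds the exponent of the action of
    a Sylow subgroup on P, but does not make it abelian. *)
Definition commutes_on (k : subgroup_kind) : bool :=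
  if k is Primary_cyclic then false else true.

Lemma kind_exponent_action k (gT : finGroupType) (p : nat)
    (A P X : {group gT}) :
    prime p -> p.-group P -> P <| A -> kind_P_subnormal k A ->
    X \subset A -> p^'.-group X ->
    k = Arbitrary \/ (exists2 q, prime q & q.-Sylow(A) X) ->
  exponent_action (commutes_on k) p X P.
Proof.
move=> pr_p pP nsPA snA sXA p'X kX.
have exY (Y : {group gT}) : Y \subset X -> of_kind k A Y ->
    exponent_action true p Y P.
  move=> sYX kY; apply: (P_subnormal_exponent_action pr_p pP nsPA) (snA Y kY).
  exact: pgroupS sYX p'X.
case: k kX snA exY => [_ | [] // [q pr_q sylX] | [] // [q pr_q sylX]] snA exY.
- exact: exY.
- by apply: exY => //; exists q.
split=> // x Xx; suff [_ exx] : exponent_action true p <[x]> P.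
  by rewrite exx ?cycle_id.
apply: exY; first by rewrite cycle_subG.
exists q => //; split; last exact: mem_p_elt (pHall_pgroup sylX) Xx.
  by rewrite cycle_subG (subsetP sXA).
exact: cycle_cyclic.
Qed.

Lemma p'Hall_join_Sylow (gT : finGroupType) (p : nat) (G L P : {group gT}) :
  p^'.-Hall(G) L -> p.-Sylow(G) P -> L \subset 'N(P) -> L <*> P = G.
Proof.
move=> hallL sylP nPL; apply/eqP.
rewrite eqEcard join_subG (pHall_sub hallL) (pHall_sub sylP) norm_joinEl //=.
rewrite TI_cardMg.
  by rewrite (card_Hall hallL) (card_Hall sylP) mulnC partnC.
rewrite setIC coprime_TIg // (pnat_coprime (pHall_pgroup sylP)) //.
exact: pHall_pgroup hallL.
Qed.

(** A subgroup H of the given kind reaches HP through the p'-part L of H, by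
    means of the action of L on P, and then reaches G because HP / P is
    P-subnormal in G / P. *)
Lemma kind_P_subnormal_extension k (gT : finGroupType) (p : nat)
    (G P : {group gT}) :
    prime p -> p.-Sylow(G) P -> P <| G -> kind_P_subnormal k (G / P)%G ->
    (forall H L : {group gT}, of_kind k G H -> p^'.-Hall(H) L ->
       exponent_action true p L P) ->
  kind_P_subnormal k G.
Proof.
move=> pr_p sylP nsPG snGP exP H kH; have sHG := of_kind_sub kH.
have [sPG nPG] := andP nsPG; have pP := pHall_pgroup sylP.
have solH : solvable H.
  apply: solvableS sHG _; rewrite (series_sol nsPG) (pgroup_sol pP).
  exact: kind_P_subnormal_sol snGP.
have nPH := subset_trans sHG nPG.
apply: (@P_subnormal_trans _ (H <*> P)%G); last first.
  have := P_subnormal_cosetpre (snGP _ (of_kind_quotient nPG kH)).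
  have -> : (coset P @*^-1 (H / P))%G = (H <*> P)%G.
    by apply: group_inj; rewrite /= quotientK // norm_joinEl // (normC nPH).
  have -> // : (coset P @*^-1 (G / P))%G = G.
  by apply: group_inj; rewrite /= quotientGK.
have [L hallL] := Hall_exists p^' solH.
have sLH := pHall_sub hallL; have p'L := pHall_pgroup hallL.
have sylR : p.-Sylow(H) (P :&: H)%G by apply: setI_normal_Hall nsPG sylP sHG.
have nRH : H \subset 'N(P :&: H) by rewrite setIC normal_norm ?(normalGI sHG).
have nRL := subset_trans sLH nRH.
have defH := p'Hall_join_Sylow hallL sylR nRL.
have -> : H = (L <*> (P :&: H))%G by apply: group_inj; rewrite /= defH.
have -> : (L <*> (P :&: H) <*> P)%G = (L <*> P)%G.
  apply: group_inj; rewrite /= -joingA; congr (_ <*> _).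
  by apply/joing_idPr; apply: subsetIl.
apply: (P_subnormal_joinG pr_p) => //; last exact: subsetIl.
  exact: subset_trans sLH nPH.
exact: exP kH hallL.
Qed.

Lemma mutually_permutable_sym (gT : finGroupType) (P Q : {group gT}) :
  mutually_permutable P Q -> mutually_permutable Q P.
Proof. by case=> permP permQ; split=> U sU; rewrite ?permP ?permQ. Qed.

(** * Products of msp-permutable subgroups *)

Lemma msp_permutable_sym (gT : finGroupType) (A B : {group gT}) :
  msp_permutable A B -> msp_permutable B A.
Proof.
case=> gAB permAB; split.
  by apply/comm_group_setP/commute_sym/comm_group_setP.
move=> p q P Q pr_p pr_q neq_pq sylP sylQ; apply: mutually_permutable_sym.
by apply: permAB sylQ sylP => //; rewrite eq_sym.
Qed.

Lemma msp_permutable_quotient (gT : finGroupType) (A B N : {group gT}) :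
    A \subset 'N(N) -> B \subset 'N(N) -> msp_permutable A B ->
  msp_permutable (A / N)%G (B / N)%G.
Proof.
move=> nNA nNB [gAB permAB]; split.
  apply/comm_group_setP; rewrite /commute -!quotientMl //.
  by move/comm_group_setP: gAB => ->.
move=> p q Pb Qb pr_p pr_q neq_pq /(Sylow_quotient_lift nNA)[P sylP ->].
move=> /(Sylow_quotient_lift nNB)[Q sylQ ->].
have [permP permQ] := permAB p q P Q pr_p pr_q neq_pq sylP sylQ.
have nNP := subset_trans (pHall_sub sylP) nNA.
have nNQ := subset_trans (pHall_sub sylQ) nNB.
have liftU (C : {group gT}) (U : {group coset_of N}) : U \subset C / N ->
    U :=: (C :&: coset N @*^-1 U) / N.
  by move=> sUC; rewrite /quotient morphim_setIpre (setIidPr _).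
split=> [U sUP | V sVQ].
  have nNU : P :&: coset N @*^-1 U \subset 'N(N) by rewrite subIset ?nNP.
  by rewrite (liftU _ _ sUP) -!quotientMl // permP ?subsetIl.
have nNV : Q :&: coset N @*^-1 V \subset 'N(N) by rewrite subIset ?nNQ.
by rewrite (liftU _ _ sVQ) -!quotientMl // permQ ?subsetIl.
Qed.

(** For q < p this is the statement on mutually permutable subgroups; a prime q
    > p does not divide the order of B, and then Q = 1. *)
Lemma msp_permutable_normalizes (gT : finGroupType) (p q : nat)
    (A B P Q : {group gT}) :
    msp_permutable A B -> prime p -> {in \pi(B), forall r, r <= p} ->
    p.-Sylow(A) P -> prime q -> q != p -> q.-Sylow(B) Q ->
  normalizes_subgroups Q P.
Proof.
move=> [_ permAB] pr_p le_p sylP pr_q neq_qp sylQ.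
have permPQ : mutually_permutable P Q.
  by apply: permAB sylP sylQ => //; rewrite eq_sym.
have [qB | q'B] := boolP (q \in \pi(B)).
  apply: (mutually_permutable_normalizes pr_p pr_q) permPQ.
  - by rewrite ltn_neqAle neq_qp le_p.
  - exact: pHall_pgroup sylP.
  - exact: pHall_pgroup sylQ.
suff -> : Q :=: 1 by move=> U _; apply: sub1G.
apply/eqP; rewrite trivg_card1 (card_Hall sylQ).
by apply: contraR q'B; rewrite -p_part_gt1 ltn_neqAle eq_sym part_gt0 andbT.
Qed.

(** The set pi of primes for which A and B are known to control the action of
    their Hall pi-subgroups depends on the kind: all primes other than p, or a
    single prime q. *)
Lemma kind_Hall_prime_set k (gT : finGroupType) (p : nat) (G H L : {group gT}) :
    of_kind k G H -> L \subset H -> p^'.-group L -> L :!=: 1 ->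
  exists pi : nat_pred, [/\ p \notin pi, pi.-group L &
    k = Arbitrary \/ exists2 q, prime q & pi =i (q : nat_pred)].
Proof.
move=> kH sLH p'L ntL.
have [Dk | [q pr_q qH]] : k = Arbitrary \/ exists2 q, prime q & q.-group H.
- case: k kH => /= [_ | [q pr_q /pHall_pgroup qH] | [q pr_q [_ _ qH]]].
  + by left.
  + by right; exists q.
  + by right; exists q.
- by exists p^'; split; rewrite ?inE ?eqxx //; left.
exists (q : nat_pred); split; last by right; exists q.
  apply: contraNN ntL; rewrite inE => /eqP Dp.
  rewrite trivg_card1 (@pnat_1 p #|L|) //; rewrite Dp; exact: pgroupS sLH qH.
exact: pgroupS sLH qH.
Qed.

(** X lies in a conjugate of a Hall pi-subgroup K that is the product of Hall
    pi-subgroups of A and B, and P is invariant under this conjugation. *)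
Lemma msp_exponent_action k (gT : finGroupType) (p : nat) (pi : nat_pred)
    (G A B P X : {group gT}) :
    prime p -> A * B = G -> solvable G -> p.-Sylow(G) P -> P <| G ->
    'O_p(A) * 'O_p(B) = P ->
    kind_P_subnormal k A -> kind_P_subnormal k B ->
    (forall (q : nat) (Q : {group gT}), prime q -> q != p -> q.-Sylow(B) Q ->
       normalizes_subgroups Q 'O_p(A)) ->
    (forall (q : nat) (Q : {group gT}), prime q -> q != p -> q.-Sylow(A) Q ->
       normalizes_subgroups Q 'O_p(B)) ->
    p \notin pi ->
    k = Arbitrary \/ (exists2 q, prime q & pi =i (q : nat_pred)) ->
    X \subset G -> pi.-group X ->
  exponent_action (commutes_on k) p X P.
Proof.
move=> pr_p defG solG sylP nsPG defP snA snB nBA nAB p_pi kpi sXG piX.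
have sAG : A \subset G by rewrite -defG mulG_subl.
have sBG : B \subset G by rewrite -defG mulG_subr.
have [H hallH] := Hall_exists pi solG.
have [A1 hallA1] := Hall_exists pi (solvableS sAG solG).
have [B1 hallB1] := Hall_exists pi (solvableS sBG solG).
have subJ (Y : {group gT}) : Y \subset G -> pi.-group Y ->
    exists2 g, g \in G & Y \subset H :^ g by apply: Hall_subJ.
have [A2 [B2 [K [hallA2 hallB2 hallK defK]]]] :=
  factorized_Hall defG hallH subJ hallA1 hallB1.
have p'pi (Y : {group gT}) : pi.-group Y -> p^'.-group Y.
  by apply: sub_pgroup => r pir; rewrite !inE; apply: contraNneq p_pi => <-.
have kHall (C Y : {group gT}) : pi.-Hall(C) Y ->
    k = Arbitrary \/ (exists2 q, prime q & q.-Sylow(C) Y).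
  move=> hallY; case: kpi => [|[q pr_q eq_pi]]; [by left | right].
  by exists q => //; rewrite -(eq_pHall _ _ eq_pi).
have [g Gg sXK] := Hall_subJ solG hallK sXG piX.
have exK : exponent_action (commutes_on k) p K P.
  have defK' : A2 <*> B2 = K.
    by rewrite comm_joingE //; apply/comm_group_setP; rewrite defK groupP.
  have p'K : p^'.-group (A2 <*> B2).
    by rewrite /= defK' p'pi ?(pHall_pgroup hallK).
  rewrite -defK'.
  have exA : exponent_action (commutes_on k) p A2 'O_p(A).
    apply: kind_exponent_action (pcore_normal p A) _ _ _ _ => //.
    - exact: pcore_pgroup.
    - exact: pHall_sub hallA2.
    - exact: p'pi (pHall_pgroup hallA2).
    - exact: kHall.
  have exB : exponent_action (commutes_on k) p B2 'O_p(B).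
    apply: kind_exponent_action (pcore_normal p B) _ _ _ _ => //.
    - exact: pcore_pgroup.
    - exact: pHall_sub hallB2.
    - exact: p'pi (pHall_pgroup hallB2).
    - exact: kHall.
  apply: (exponent_action_mul pr_p (pHall_pgroup sylP) defP p'K _ exA _ _ exB).
  - exact: subset_trans (pHall_sub hallA2) (gFnorm _ _).
  - apply: p'group_normalizes_subgroups nBA (pHall_sub hallB2) _.
    exact: p'pi (pHall_pgroup hallB2).
  - exact: subset_trans (pHall_sub hallB2) (gFnorm _ _).
  - apply: p'group_normalizes_subgroups nAB (pHall_sub hallA2) _.
    exact: p'pi (pHall_pgroup hallA2).
have := exponent_actionJ g exK; rewrite (normsP (normal_norm nsPG) g Gg).
exact: exponent_actionS.
Qed.

(** It is enough to treat the Sylow subgroups of A: the Sylow p-subgroup lies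
    in P, and the others normalise both factors of P. *)
Lemma Sylow_factor_norm (gT : finGroupType) (p : nat) (A P R : {group gT}) :
    p.-Sylow(A) 'O_p(A) -> 'O_p(A) * R = P ->
    (forall (q : nat) (Q : {group gT}), prime q -> q != p -> q.-Sylow(A) Q ->
       normalizes_subgroups Q R) ->
  A \subset 'N(P).
Proof.
move=> sylA defP nAR; rewrite -(Sylow_gen A) gen_subG.
apply/bigcupsP=> Q /SylowP[q pr_q sylQ].
have [eq_qp | neq_qp] := eqVneq q p.
  rewrite eq_qp in sylQ; rewrite (eq_Hall_pcore sylA sylQ).
  by rewrite (subset_trans _ (normG P)) // -defP mulG_subl.
rewrite -defP; apply: normsM; last exact: nAR sylQ _ (subxx _).
exact: subset_trans (pHall_sub sylQ) (gFnorm _ _).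
Qed.

Lemma msp_kind_P_subnormal k (gT : finGroupType) (G A B : {group gT}) :
    A * B = G -> msp_permutable A B ->
    kind_P_subnormal k A -> kind_P_subnormal k B ->
  kind_P_subnormal k G.
Proof.
have [n] := ubnP #|G|.
elim: n gT G A B => // n IHn gT G A B ltn defG mspAB snA snB.
have [G1 | ntG] := eqsVneq G 1.
  move=> H /of_kind_sub; rewrite G1 => /trivgP H1.
  have -> : H = G by apply: group_inj; rewrite H1.
  exact: P_subnormal_refl.
have sAG : A \subset G by rewrite -defG mulG_subl.
have sBG : B \subset G by rewrite -defG mulG_subr.
have [p Dp] : {p | p = max_pdiv #|G|} by exists (max_pdiv #|G|).
have pr_p : prime p by rewrite Dp max_pdiv_prime ?cardG_gt1.
have le_p (H : {group gT}) : H \subset G -> {in \pi(H), forall q, q <= p}.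
  by rewrite Dp; apply: pi_le_max_pdiv.
have sylA := kind_pcore_Sylow pr_p (le_p A sAG) snA.
have sylB := kind_pcore_Sylow pr_p (le_p B sBG) snB.
have mspBA := msp_permutable_sym mspAB.
have nBA (q : nat) (Q : {group gT}) : prime q -> q != p -> q.-Sylow(B) Q ->
    normalizes_subgroups Q 'O_p(A).
  exact: msp_permutable_normalizes mspAB pr_p (le_p B sBG) sylA.
have nAB (q : nat) (Q : {group gT}) : prime q -> q != p -> q.-Sylow(A) Q ->
    normalizes_subgroups Q 'O_p(B).
  exact: msp_permutable_normalizes mspBA pr_p (le_p A sAG) sylB.
have [S sylS] := Sylow_exists p G.
have subJ (Y : {group gT}) : Y \subset G -> p.-group Y ->
    exists2 g, g \in G & Y \subset S :^ g by apply: Sylow_subJ.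
have [A2 [B2 [P [sylA2 sylB2 sylP]]]] :=
  factorized_Hall defG sylS subJ sylA sylB.
have -> : A2 :=: 'O_p(A) by apply: eq_Hall_pcore.
have -> : B2 :=: 'O_p(B) by apply: eq_Hall_pcore.
move=> defP.
have nPA : A \subset 'N(P) := Sylow_factor_norm sylA defP nAB.
have nPB : B \subset 'N(P).
  apply: Sylow_factor_norm sylB _ nBA.
  by rewrite -defP; apply/esym/comm_group_setP; rewrite defP groupP.
have nsPG : P <| G by rewrite /normal (pHall_sub sylP) -defG mul_subG.
have ntP : P :!=: 1.
  by rewrite -cardG_gt1 (card_Hall sylP) p_part_gt1 Dp pi_max_pdiv cardG_gt1.
have snGP : kind_P_subnormal k (G / P)%G.
  apply: (IHn _ _ (A / P)%G (B / P)%G).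
  - rewrite -ltnS; apply: leq_trans ltn; rewrite ltnS.
    exact: ltn_quotient ntP (pHall_sub sylP).
  - by rewrite -quotientMl ?defG.
  - exact: msp_permutable_quotient.
  - exact: kind_P_subnormal_quotient.
  - exact: kind_P_subnormal_quotient.
have solG : solvable G.
  rewrite (series_sol nsPG) (pgroup_sol (pHall_pgroup sylP)).
  exact: kind_P_subnormal_sol snGP.
apply: (kind_P_subnormal_extension pr_p sylP nsPG snGP) => H L kH hallL.
have sLH := pHall_sub hallL.
have [L1 | ntL] := eqVneq (L : {set gT}) 1.
  rewrite L1; split=> [_ | x /set1P->]; first by rewrite comm1G sub1G.
  by rewrite expg1n group1.
have [pi [p_pi piL kpi]] := kind_Hall_prime_set kH sLH (pHall_pgroup hallL) ntL.
have sLG := subset_trans sLH (of_kind_sub kH).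
(* For the primary cyclic kind L is abelian, hence so is its action. *)
have := msp_exponent_action pr_p defG solG sylP nsPG defP snA snB nBA nAB
          p_pi kpi sLG piL.
case: (k) kH => //= [[q pr_q [_ cycH _]]]; apply: exponent_action_comm.
exact: abelianS sLH (cyclic_abelian cycH).
Qed.

(** * Supersolubility *)

(** Multiply H by the terms of a chief series of G: each index divides the
    order of the corresponding chief factor. *)
Lemma supersoluble_P_subnormal (gT : finGroupType) (G : {group gT}) :
  supersoluble G -> kind_P_subnormal Arbitrary G.
Proof.
move=> ssG H sHG.
have [s chs lasts] := chief_series_exists (normal_refl G).
suff climb (V : {group gT}) :
    path (fun X Y : {group gT} => chief_factor G X Y) V s ->
    last V s = G -> P_subnormal (H <*> V)%G G.
  have := climb 1%G chs lasts; have -> // : (H <*> 1)%G = H.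
  by apply: group_inj; rewrite /= joingG1.
elim: s V {chs lasts} => /= [V _ -> | U s IHs V /andP[chU chs] lastU].
  have -> : (H <*> G)%G = G by apply/group_inj/joing_idPr.
  exact: P_subnormal_refl.
apply: P_subnormal_trans (IHs U chs lastU).
have pr_UV := ssG V U chU.
have /andP[/maxgroupp/andP[/andP[sVU _] nVG] /andP[sUG nUG]] := chU.
have eqHU : H <*> U = (H <*> V) * U.
  rewrite !norm_joinEl ?(subset_trans sHG) //.
  by rewrite -mulgA (mulSGid sVU).
apply: (P_subnormal_step pr_UV); first by rewrite genS ?setUS.
rewrite [in X in X %| _]/= eqHU indexMg card_quotient ?(subset_trans sUG) //.
by rewrite -indexgI indexgS // subsetI sVU joing_subr.
Qed.

(** With P the normal Sylow subgroup for the largest prime p, either M avoids P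
    and is isomorphic to a minimal normal subgroup of G / P, or M is contained
    in Z(P). In the latter case G acts on M through a p'-complement L of P, and
    an L-invariant subgroup of order p is normal in G. *)
Lemma minnormal_prime (gT : finGroupType) (G M : {group gT}) :
    kind_P_subnormal Arbitrary G -> minnormal M G -> M \subset G ->
  prime #|M|.
Proof.
have [n] := ubnP #|G|; elim: n gT G M => // n IHn gT G M ltn snG minM sMG.
have [/andP[ntM nMG] minM'] := mingroupP minM.
have ntG : G :!=: 1 by apply: contraNneq ntM => G1; rewrite -subG1 -G1.
have [p Dp] : {p | p = max_pdiv #|G|} by exists (max_pdiv #|G|).
have pr_p : prime p by rewrite Dp max_pdiv_prime ?cardG_gt1.
have sylP : p.-Sylow(G) 'O_p(G).
  apply: (kind_pcore_Sylow pr_p _ snG); rewrite Dp.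
  exact: pi_le_max_pdiv.
have solG := kind_P_subnormal_sol snG.
set P := 'O_p(G)%G in sylP.
have nsPG : P <| G := pcore_normal p G.
have [sPG nPG] := andP nsPG; have pP : p.-group P := pcore_pgroup p G.
have [sMP | nsMP] := boolP (M \subset P).
  have nsMP : M <| P by rewrite /normal sMP (subset_trans sPG).
  have sMZ : M \subset 'Z(P).
    have ntMZ := meet_center_nil (pgroup_nil pP) nsMP ntM.
    rewrite -(minM' (M :&: 'Z(P))%G) ?subsetIl ?subsetIr //.
    by rewrite ntMZ normsI // (gFnorm_trans _ nPG).
  have cMP : P \subset 'C(M) by rewrite centsC (subset_trans sMZ) ?subsetIr.
  have pM := pgroupS sMP pP.
  have abelM : p.-abelem M.
    rewrite -(is_abelem_pgroup pM).
    by have [] := minnormal_solvable minM sMG solG.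
  have [L hallL] := Hall_exists p^' solG.
  have sLG := pHall_sub hallL; have p'L := pHall_pgroup hallL.
  have exL : exponent_action true p L P.
    exact: P_subnormal_exponent_action pr_p pP nsPG p'L (snG L sLG).
  have exLM := exponent_actionS (subxx L) sMP exL.
  have [N [sNM oN nNL]] := exponent_action_invariant_order_p pr_p abelM ntM
    (subset_trans sLG nMG) exLM.
  have defG := p'Hall_join_Sylow hallL sylP (subset_trans sLG nPG).
  rewrite -(minM' N) ?oN //; apply/andP; split.
    by rewrite -cardG_gt1 oN prime_gt1.
  rewrite -defG join_subG nNL.
  exact: subset_trans cMP (subset_trans (centS sNM) (cent_sub N)).
have tiPM : P :&: M = 1.
  apply/eqP/idPn=> ntI; case/negP: nsMP.
  by rewrite -(minM' (P :&: M)%G) ?subsetIl ?subsetIr // ntI normsI.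
have nPM := subset_trans sMG nPG.
rewrite (card_isog (quotient_isog nPM tiPM)).
apply: (IHn _ (G / P)%G (M / P)%G); last exact: quotientS.
- rewrite -ltnS; apply: leq_trans ltn; rewrite ltnS ltn_quotient //.
  exact: pcore_max_pdiv_neq1 Dp ntG sylP.
- exact: kind_P_subnormal_quotient.
apply/mingroupP; split=> [|K /andP[ntK nKG] sKM].
  rewrite quotient_norms // andbT -cardG_gt1.
  by rewrite -(card_isog (quotient_isog nPM tiPM)) cardG_gt1.
have defK : K :=: (M :&: coset P @*^-1 K) / P.
  by rewrite /quotient morphim_setIpre (setIidPr _).
rewrite /= -(minM' (M :&: coset P @*^-1 K)%G) ?subsetIl //.
apply/andP; split.
  by apply: contraNneq ntK => K1; rewrite defK K1 quotient1.
by rewrite normsI // norm_quotient_pre.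
Qed.

Lemma P_subnormal_supersoluble (gT : finGroupType) (G : {group gT}) :
  kind_P_subnormal Arbitrary G -> supersoluble G.
Proof.
move=> snG V U chU; have /andP[/maxgroupp/andP[_ nVG] /andP[sUG _]] := chU.
apply: (@minnormal_prime _ (G / V)%G (U / V)%G).
- exact: kind_P_subnormal_quotient.
- exact: chief_factor_minnormal.
- exact: quotientS.
Qed.

Lemma w_supersolubleP (gT : finGroupType) (G : {group gT}) :
  w_supersoluble G <-> kind_P_subnormal Sylow_subgroup G.
Proof.
split=> [wG H [p pr_p sylH] | snG p P pr_p sylP]; first exact: wG sylH.
by apply: snG; exists p.
Qed.

Lemma v_supersolubleP (gT : finGroupType) (G : {group gT}) :
  v_supersoluble G <-> kind_P_subnormal Primary_cyclic G.
Proof.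
split=> [vG H [p pr_p [sHG cycH pH]] | snG p C pr_p sCG cycC pC].
  exact: vG pH.
by apply: snG; exists p.
Qed.

Theorem corollary3p1 (gT : finGroupType) (G G1 G2 : {group gT})
    (hG : G1 * G2 = G) (hmsp : msp_permutable G1 G2) :
  (supersoluble G1 -> supersoluble G2 -> supersoluble G) /\
  (w_supersoluble G1 -> w_supersoluble G2 -> w_supersoluble G) /\
  (v_supersoluble G1 -> v_supersoluble G2 -> v_supersoluble G).
Proof.
have main k := msp_kind_P_subnormal (k := k) hG hmsp.
split; last split.
- move=> /supersoluble_P_subnormal sn1 /supersoluble_P_subnormal sn2.
  exact: P_subnormal_supersoluble (main _ sn1 sn2).
- move=> /w_supersolubleP sn1 /w_supersolubleP sn2.
  exact/w_supersolubleP/main.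
- move=> /v_supersolubleP sn1 /v_supersolubleP sn2.
  exact/v_supersolubleP/main.
Qed.
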